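(* For every integer base $b\geq 2$, every fixed integer $j$ with $0\leq j<b$, and every nonnegative integer $n$, $$\sum_{k\geq 1}\left\lfloor\frac{n+jb^{k-1}}{b^k}\right\rfloor=\frac{n-s_b(n)}{b-1}+\lambda'_{b-j},$$ where $s_b(n)$ is the sum of the $b$-ary digits of $n$ and $\lambda'_{i}$ is the number of $b$-ary digits of $n$ that are greater than or equal to $i$. (Only finitely many terms of the sum are nonzero.)
   Context: For $n\geq 1$ write the $b$-ary expansion $n=c_mb^m+c_{m-1}b^{m-1}+\cdots+c_1b+c_0$ with $c_i\in\{0,1,\dots,b-1\}$, $m=\lfloor\log_b n\rfloor$ and leading digit $c_m\neq 0$. Then $s_b(n)=\sum_{s=0}^{m}c_s$. Let $\lambda=\lambda(n,b)$ be the partition obtained by writing the multiset of digits $\{c_0,\dots,c_m\}$ in descending order, and let $\lambda'=\lambda'(n,b)=(\lambda'_1\geq\cdots\geq\lambda'_{b-1})$ be the transpose partition; equivalently $\lambda'_i=\#\{s: 0\leq s\leq m,\ c_s\geq i\}$. In particular $\lambda'_b=0$, since all digits are at most $b-1$ (this is the case $j=0$). For $n=0$ one has $s_b(0)=0$ and $\lambda'_i=0$ for all $i\geq 1$. *)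

(* Defs.v *)
From HB Require Import structures.
From mathcomp Require Import all_boot all_order all_algebra.
From mathcomp Require Import boolp classical_sets functions cardinality fsbigop.

Set Implicit Arguments.
Unset Strict Implicit.
Unset Printing Implicit Defensive.

(* Least significant digit first.  For b >= 2 and n >= 1, trunc_log b n is
   floor (log_b n), so the last entry is the nonzero leading digit.  For n = 0
   this is [:: 0], whose digit sum is 0 and which has no digit >= i for i >= 1. *)
Definition digits (b n : nat) : seq nat :=
  mkseq (fun s => (n %/ b ^ s) %% b) (trunc_log b n).+1.

Definition digit_sum (b n : nat) : nat := \sum_(c <- digits b n) c.

(* The i-th part, for i >= 1, of the transpose of the partition formed by the
   digits. *)
Definition lambda' (b n i : nat) : nat := count (fun c => i <= c) (digits b n).

Definition floor_term (b j n k : nat) : int :=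
  Num.floor ((n%:R + j%:R * b%:R ^+ k.-1) / b%:R ^+ k : rat)%R.

(* Main.v *)
(* With c_s the s-th digit of n, the term of index k = s + 1 equals
   floor ((floor (n / b^s) + j) / b), that is, floor (n / b^(s+1)) plus a carry,
   which is 1 exactly when c_s >= b - j.  The carries add up to lambda'_(b-j).
   The remaining sum is Legendre's: c_s = floor (n / b^s) - b floor (n / b^(s+1))
   telescopes to s_b(n) = n - (b - 1) * sum_(k >= 1) floor (n / b^k). *)
Require Import Defs.
From HB Require Import structures.
From mathcomp Require Import all_boot all_order all_algebra.
From mathcomp Require Import boolp classical_sets functions cardinality fsbigop.

Set Implicit Arguments.
Unset Strict Implicit.
Unset Printing Implicit Defensive.

Import Order.TTheory GRing.Theory Num.Theory.
Local Open Scope classical_set_scope.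
Local Open Scope ring_scope.

Lemma floor_natr_div (m d : nat) : (0 < d)%N ->
  Num.floor (m%:R / d%:R : rat) = (m %/ d)%N.
Proof.
move=> d_gt0; apply: floor_def; have d0 : (0 : rat) < d%:R by rewrite ltr0n.
rewrite -PoszD -!pmulrn ler_pdivlMr // ltr_pdivrMr // -!natrM ler_nat ltr_nat.
by rewrite leq_divM addn1 ltn_ceil.
Qed.

Lemma floor_term_succ (b j n s : nat) : (0 < b)%N ->
  floor_term b j n s.+1 = ((n %/ b ^ s + j) %/ b)%N.
Proof.
move=> b_gt0; rewrite /floor_term /= -!natrX -natrM -natrD.
rewrite floor_natr_div ?expn_gt0 ?b_gt0 //.
by rewrite expnSr divnMA divnDMl // expn_gt0 b_gt0.
Qed.

(** Since [j < b], [j] is its own remainder and adds nothing to the quotient; only an overflow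
    [m %% b + j >= b] can. *)
Lemma divnD_carry (b j m : nat) : (j < b)%N ->
  ((m + j) %/ b = m %/ b + (b - j <= m %% b))%N.
Proof.
move=> lt_jb; have b_gt0 : (0 < b)%N by apply: leq_ltn_trans lt_jb.
by rewrite divnD // (divn_small lt_jb) (modn_small lt_jb) addn0 leq_subLR [(j + _)%N]addnC.
Qed.

(** Legendre's formula cut off at [N] and free of subtraction: the term [n %/ b ^ N] keeps it exact
    for every [N], which allows induction, and vanishes once [n < b ^ N]. *)
Lemma sum_digits_legendre (b n N : nat) : (0 < b)%N ->
  (b.-1 * (\sum_(s < N) n %/ b ^ s.+1) + \sum_(s < N) (n %/ b ^ s) %% b
    + n %/ b ^ N = n)%N.
Proof.
move=> b_gt0; elim: N => [|N IH]; first by rewrite !big_ord0 muln0 expn0 divn1.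
(* With [q = n %/ b ^ N.+1], the new terms [b.-1 * q] and [q] merge into [b * q], which together
   with digit [N] restores [n %/ b ^ N]. *)
rewrite !big_ord_recr /= -[RHS]IH mulnDr -!addnA; congr addn.
rewrite addnCA; congr addn; rewrite addnCA addnA.
rewrite [(_ + b.-1 * _)%N]addnC -addnA [(_ %% b + _)%N]addnC addnA.
rewrite -mulSnr prednK // expnSr divnMA mulnC.
by rewrite -divn_eq.
Qed.

Lemma big_digits (b n : nat) (F : nat -> nat) :
  (\sum_(c <- digits b n) F c
    = \sum_(s < (trunc_log b n).+1) F ((n %/ b ^ s) %% b))%N.
Proof. by rewrite big_map -[X in iota 0 X]subn0 -/(index_iota 0 _) big_mkord. Qed.

Theorem theorem2 (b j n : nat) (hb : (2 <= b)%N) (hj : (j < b)%N) :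
  finite_set [set k : nat | (1 <= k)%N /\ floor_term b j n k <> 0] /\
  (\sum_(k \in [set k : nat | (1 <= k)%N]) floor_term b j n k)%:~R =
    (n%:R - (digit_sum b n)%:R) / (b%:R - 1) + (lambda' b n (b - j))%:R :> rat.
Proof.
have b_gt0 : (0 < b)%N by apply: ltnW.
set N := (trunc_log b n).+1.
have lt_n_bN : (n < b ^ N)%N by apply: trunc_log_ltn.
(* The bound is strict because the leading digit has index [N - 1] and may carry, so the term at
   [k = N] can be nonzero. Beyond it only [j %/ b = 0] remains. *)
have term0 k : (N < k)%N -> floor_term b j n k = 0.
  case: k => // s le_Ns; rewrite floor_term_succ // (@divn_small n) ?divn_small //.
  by apply: leq_trans lt_n_bN _; rewrite leq_exp2l.
split.
  apply: (@sub_finite_set _ _ `I_N.+1); last exact: finite_II.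
  move=> k /= [_ nz_k]; rewrite ltnS leqNgt; apply/negP => /term0.
  exact: nz_k.
rewrite (@fsbigE _ _ _ _ _ (index_iota 1 N.+1)) ?iota_uniq //; first last.
- by move=> k /= k_gt0; rewrite mem_index_iota k_gt0 ltnS -ltnNge => /term0.
- by move=> k /=; rewrite mem_index_iota => /andP[].
rewrite big_nat_cond (eq_bigl (fun k => 1 <= k < N.+1)%N) -?big_nat; last first.
  by move=> k; case: (ltnP 0 k) => //= k_gt0; rewrite mem_set ?andbT.
rewrite big_add1 /= big_mkord.
under eq_bigr => s _ do
  rewrite floor_term_succ // divnD_carry // -divnMA -expnSr.
have -> : lambda' b n (b - j) = (\sum_(s < N) (b - j <= (n %/ b ^ s) %% b))%N.
  by rewrite /lambda' -sumn_count sumnE big_map big_digits.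
have -> : digit_sum b n = (\sum_(s < N) (n %/ b ^ s) %% b)%N.
  exact: big_digits.
have := sum_digits_legendre n N b_gt0; rewrite (divn_small lt_n_bN) addn0.
set L := (\sum_(s < N) n %/ _)%N; set D := (\sum_(s < N) _ %% _)%N => nE.
rewrite -(big_morph Posz PoszD (erefl 0)) -pmulrn big_split natrD; congr (_ + _).
have b1 : b%:R - 1 = b.-1%:R :> rat by rewrite -(natrB _ b_gt0) subn1.
(* Legendre's formula turns [n - D] into [(b - 1) * L], and [b - 1] cancels because [b >= 2]. *)
rewrite -[in RHS]nE natrD addrK natrM b1 mulrAC mulfV ?mul1r //.
by rewrite pnatr_eq0 -lt0n -subn1 subn_gt0.
Qed.
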